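(* Let $\mathcal{N}$ be a nest. Suppose that for every positive integer $q$ there is a chain $N_0<N_1<\dots<N_q$ in $\mathcal{N}$ such that $$\dim(N_j\ominus N_{j-1})\ge\dim(N_{j+1}\ominus N_j)\quad\text{for }1\le j<q.$$ Then $\mathrm{rtsr}(\mathcal{T}(\mathcal{N}))=\infty$.
   Context: A nest $\mathcal{N}$ is a complete chain (with respect to inclusion) of closed subspaces of a Hilbert space $\mathcal{H}$ containing $\{0\}$ and $\mathcal{H}$. The nest algebra $\mathcal{T}(\mathcal{N})$ is the algebra of all $T\in\mathcal{B}(\mathcal{H})$ with $TN\subset N$ for every $N\in\mathcal{N}$. For a unital Banach algebra $\mathfrak{A}$, $\mathrm{rtsr}(\mathfrak{A})$ (right topological stable rank) is the least positive integer $n$ such that the set of $(a_1,\dots,a_n)\in\mathfrak{A}^n$ for which there is $(b_1,\dots,b_n)\in\mathfrak{A}^n$ with $\sum_{i=1}^n a_ib_i=1$ is dense in $\mathfrak{A}^n$; it is $\infty$ if no such $n$ exists. *)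

(* Defs.v *)
From HB Require Import structures.
From mathcomp Require Import all_boot all_order all_algebra complex.
From mathcomp Require Import all_classical all_reals all_analysis.

Set Implicit Arguments.
Unset Strict Implicit.
Unset Printing Implicit Defensive.

Import Order.TTheory GRing.Theory Num.Theory.
Import numFieldNormedType.Exports.

Local Open Scope classical_set_scope.
Local Open Scope complex_scope.
Local Open Scope ring_scope.

HB.mixin Record CompleteNormedModule_isHilbert (R : realType) H
    of CompleteNormedModule R[i] H := {
  inner : {dot H for @Num.conj R[i]} ;
  normr_inner : forall x : H, `|x| ^+ 2 = inner x x
}.

#[short(type="hilbertType")]
HB.structure Definition Hilbert (R : realType) :=
  {H of CompleteNormedModule R[i] H & CompleteNormedModule_isHilbert R H}.

(* The multiplication is not taken from GRing.PzRing because Hierarchy-Builder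
   rejects any join of normed modules and rings: Num.NumDomain already inherits
   from both without an intermediate structure. As the zero algebra is allowed,
   `|bone| = 1 is not required. *)
HB.mixin Record CompleteNormedModule_isBanachAlgebra (K : numFieldType) A
    of CompleteNormedModule K A := {
  bone : A ;
  bmul : A -> A -> A ;
  bmulA : associative bmul ;
  bmul1 : left_id bone bmul ;
  bmulr1 : right_id bone bmul ;
  bmulDl : left_distributive bmul +%R ;
  bmulDr : right_distributive bmul +%R ;
  bscalerAl : forall (k : K) (x y : A), k *: bmul x y = bmul (k *: x) y ;
  bscalerAr : forall (k : K) (x y : A), k *: bmul x y = bmul x (k *: y) ;
  bnormrM : forall x y : A, `|bmul x y| <= `|x| * `|y|
}.

#[short(type="banachAlgType")]
HB.structure Definition BanachAlgebra (K : numFieldType) :=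
  {A of CompleteNormedModule K A & CompleteNormedModule_isBanachAlgebra K A}.

Section StableRank.
Variables (R : realType) (A : banachAlgType R[i]).

Definition right_unimodular (n : nat) : set 'rV[A]_n :=
  [set a | exists b : 'rV[A]_n, \sum_(i < n) bmul (a 0 i) (b 0 i) = bone].

(* The infimum of a set of natural numbers is its least element, and +oo if the
   set is empty. *)
Definition rtsr : \bar R :=
  ereal_inf [set n%:R%:E | n in [set n | (0 < n)%N /\ dense (@right_unimodular n)]].

End StableRank.

Section Subspaces.
Variables (R : realType) (H : hilbertType R).
Implicit Types M L E : set H.

Definition closed_subspace M :=
  [/\ M 0, forall (a : R[i]) x y, M x -> M y -> M (a *: x + y) & closed M].

Definition closed_span E : set H := smallest closed_subspace E.

Definition orthogonal_difference M L : set H :=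
  [set x | M x /\ forall y, L y -> inner x y = 0].

Definition orthonormal_basis E M :=
  [/\ forall x, E x -> inner x x = 1,
      forall x y, E x -> E y -> x <> y -> inner x y = 0
    & closed_span E = M].

(* dim M <= dim L for closed subspaces, as cardinals: orthonormal bases exist and
   any two of the same subspace are equinumerous. *)
Definition hdim_le M L := exists E F : set H,
  [/\ orthonormal_basis E M, orthonormal_basis F L & (E #<= F)%card].

End Subspaces.

(* The closed span of a chain is its join in the lattice of closed subspaces. *)
Record nest (R : realType) (H : hilbertType R) := Nest {
  nest_set : set (set H) ;
  nest_closed_subspace : forall M, nest_set M -> closed_subspace M ;
  nest_total : forall M L, nest_set M -> nest_set L -> M `<=` L \/ L `<=` M ;
  nest_set0 : nest_set [set 0] ;
  nest_setT : nest_set [set: H] ;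
  nest_bigcap : forall F : set (set H), F `<=` nest_set ->
    nest_set (\bigcap_(M in F) M) ;
  nest_bigcup : forall F : set (set H), F `<=` nest_set ->
    nest_set (closed_span (\bigcup_(M in F) M))
}.

Section NestAlgebra.
Variables (R : realType) (H : hilbertType R) (N : nest H).
Local Notation C := R[i].

Definition nest_operator : {pred H -> H} :=
  fun T => `[< [/\ linear T, continuous T & forall M, nest_set N M -> T @` M `<=` M] >].

Record nest_algebra :=
  NestOperator { nest_fun :> H -> H ; nest_funP : nest_fun \in nest_operator }.

HB.instance Definition _ := [isSub of nest_algebra for nest_fun].
HB.instance Definition _ := [Choice of nest_algebra by <:].

Local Lemma normE (x : H) : `|x| = (complex.Re `|x|)%:C.
Proof. by rewrite RRe_real// normr_real. Qed.

Local Lemma Re_normK (z : C) : (complex.Re `|z|)%:C = `|z|.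
Proof. by rewrite RRe_real// normr_real. Qed.

Local Lemma Re_norm_ge0 (z : C) : 0 <= complex.Re `|z|.
Proof. by rewrite -ler0c Re_normK. Qed.
#[local] Hint Resolve Re_norm_ge0 : core.

Local Lemma CD (a b : R) : (a + b)%:C = a%:C + b%:C. Proof. exact: rmorphD. Qed.

Local Lemma CM (a b : R) : (a * b)%:C = a%:C * b%:C. Proof. exact: rmorphM. Qed.

Local Lemma linear0f (T : H -> H) : linear T -> T 0 = 0.
Proof.
by move=> lT; have := lT (-1) 0 0; rewrite scaler0 addr0 scaleN1r addNr.
Qed.

Local Lemma linearZf (T : H -> H) : linear T -> forall a x, T (a *: x) = a *: T x.
Proof. by move=> lT a x; have := lT a x 0; rewrite !addr0 linear0f// addr0. Qed.

Local Lemma linearDf (T : H -> H) : linear T -> forall x y, T (x + y) = T x + T y.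
Proof. by move=> lT x y; have := lT 1 x y; rewrite !scale1r. Qed.

Local Lemma bounded_of_continuous (T : H -> H) : linear T -> continuous T ->
  exists2 k : R, 0 <= k & forall x, `|T x| <= k%:C * `|x|.
Proof.
move=> lT cT; pose m := GRing.isLinear.Build _ _ _ _ T lT.
pose g : {linear H -> H} := HB.pack T m.
have /linear_boundedP[y [yreal fr]] := @continuous_linear_bounded _ _ _ 0 g (cT 0).
exists (complex.Re `|y| + 1).
  by rewrite addr_ge0.
apply: fr; rewrite (le_lt_trans (real_ler_norm yreal))//.
rewrite CD Re_normK ltrDl; exact: ltr01.
Qed.

Local Lemma continuous_of_bounded (T : H -> H) (k : R) : linear T ->
  (forall x, `|T x| <= k%:C * `|x|) -> continuous T.
Proof.
move=> lT bT; pose m := GRing.isLinear.Build _ _ _ _ T lT.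
pose g : {linear H -> H} := HB.pack T m.
apply: (@bounded_linear_continuous _ _ _ g).
apply/linear_boundedP; exists k%:C; split; first by apply/complex_realP; exists k.
by move=> r kr x; rewrite (le_trans (bT x))// ler_wpM2r// ltW.
Qed.

Fact nest_operator_submod_closed : submod_closed nest_operator.
Proof.
split.
  apply/asboolP; split=> [a x y||M NM _ [x Mx <-]].
  - by rewrite /GRing.zero/= scaler0 addr0.
  - exact: cst_continuous.
  - by have [] := nest_closed_subspace NM.
move=> a S T /asboolP[lS cS NS] /asboolP[lT cT NT].
apply/asboolP; split=> [b x y|x|M NM _ [x Mx <-]].
- rewrite !fctE/= lS lT !scalerDr !scalerA [b * a]mulrC.
  by rewrite addrACA.
- by apply: cvgD; [apply: cvgZl_tmp; exact: cS|exact: cT].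
- have [M0 MD _] := nest_closed_subspace NM.
  by apply: MD; [apply: (NS M)|apply: (NT M)] => //; exists x.
Qed.
HB.instance Definition _ :=
  GRing.isSubmodClosed.Build C (H -> H) nest_operator nest_operator_submod_closed.
HB.instance Definition _ := [SubChoice_isSubLmodule of nest_algebra by <:].

Implicit Types S T : nest_algebra.

Lemma nest_linear T : linear T. Proof. by have /asboolP[] := nest_funP T. Qed.
Lemma nest_continuous T : continuous T. Proof. by have /asboolP[] := nest_funP T. Qed.
Lemma nest_stable T M : nest_set N M -> T @` M `<=` M.
Proof. by have /asboolP[_ _] := nest_funP T; exact. Qed.

Definition opnorm (T : H -> H) : R :=
  sup [set complex.Re `|T x| | x in [set x : H | `|x| <= 1]].

Lemma nest_opnorm_has_ub T :
  has_ubound [set complex.Re `|T x| | x in [set x : H | `|x| <= 1]].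
Proof.
have [k k0 Tk] := bounded_of_continuous (@nest_linear T) (@nest_continuous T).
exists k => _ [x /= x1 <-]; rewrite -lecR -normE (le_trans (Tk x))//.
by rewrite ler_piMr// ler0c.
Qed.

Lemma nest_opnorm_ge0 T : 0 <= opnorm T.
Proof.
apply: ub_le_sup; first exact: nest_opnorm_has_ub.
by exists 0 => /=; rewrite ?linear0f ?normr0//; exact: nest_linear.
Qed.
#[local] Hint Resolve nest_opnorm_ge0 : core.

Lemma nest_opnormP T x : `|T x| <= (opnorm T)%:C * `|x|.
Proof.
have [->|x0] := eqVneq x 0.
  by rewrite linear0f ?normr0 ?mulr0//; exact: nest_linear.
have nx : 0 < `|x| by rewrite normr_gt0.
rewrite -ler_pdivrMr//.
have -> : `|T x| / `|x| = `|T (`|x|^-1 *: x)|.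
  by rewrite linearZf; [rewrite normrZ normfV normr_id mulrC|exact: nest_linear].
rewrite normE lecR; apply: ub_le_sup; first exact: nest_opnorm_has_ub.
by exists (`|x|^-1 *: x) => //=; rewrite normrZ normfV normr_id mulVf// gt_eqF.
Qed.
#[local] Hint Resolve nest_opnormP : core.

Lemma nest_opnorm_le T (k : R) : 0 <= k -> (forall x, `|T x| <= k%:C * `|x|) ->
  opnorm T <= k.
Proof.
move=> k0 Tk; apply: ge_sup.
  by exists (complex.Re `|T 0|); exists 0 => //=; rewrite normr0.
move=> _ [x /= x1 <-]; rewrite -lecR -normE (le_trans (Tk x))//.
by rewrite ler_piMr// ler0c.
Qed.

Definition nest_norm T : C := (opnorm T)%:C.

Local Lemma onormD S T : nest_norm (S + T) <= nest_norm S + nest_norm T.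
Proof.
rewrite /nest_norm -CD lecR; apply: nest_opnorm_le; first by rewrite addr_ge0.
move=> x; rewrite CD mulrDl.
by apply: (le_trans (ler_normD (S x) (T x))); rewrite lerD.
Qed.

Local Lemma onormZ_le (k : C) T : nest_norm (k *: T) <= `|k| * nest_norm T.
Proof.
rewrite /nest_norm -Re_normK -CM lecR.
apply: nest_opnorm_le => [|x]; first by rewrite mulr_ge0.
rewrite [`|_|](normrZ k (T x)) CM Re_normK -mulrA.
by rewrite ler_wpM2l.
Qed.

Local Lemma onormZ (k : C) T : nest_norm (k *: T) = `|k| * nest_norm T.
Proof.
have [->|k0] := eqVneq k 0.
  rewrite scale0r normr0 mul0r; apply/eqP; rewrite eq_le.
  rewrite -{1}(scale0r (0 : nest_algebra)) (le_trans (onormZ_le _ _)) ?normr0 ?mul0r//=.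
  by rewrite /nest_norm ler0c.
apply/eqP; rewrite eq_le onormZ_le/= -ler_pdivlMl ?normr_gt0//.
by rewrite -{1}[T](scalerK k0) (le_trans (onormZ_le _ _))// normfV.
Qed.

Local Lemma onorm0_eq0 T : nest_norm T = 0 -> T = 0.
Proof.
move=> T0; apply/val_inj/funext => x /=; apply/eqP; rewrite -normr_le0.
by rewrite (le_trans (nest_opnormP _ _))// -/(nest_norm T) T0 mul0r.
Qed.

HB.instance Definition _ :=
  Lmodule_isNormed.Build C nest_algebra onormD onormZ onorm0_eq0.

Lemma nest_normE T : `|T| = (opnorm T)%:C. Proof. by []. Qed.

Local Lemma nest_algebra_complete (F : set_system nest_algebra) :
  ProperFilter F -> cauchy F -> cvg F.
Proof.
move=> FF /cauchy_ballP FC.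
have evalC x : cvg ((fun T : nest_algebra => T x) @ F).
  apply: cauchy_cvg; apply/cauchy_ballP => e e0.
  have e1 : 0 < e / (`|x| + 1) by rewrite divr_gt0// ltr_wpDl// ltr01.
  have [[A B]/= [FA FB] AB] := FC _ e1.
  exists ([set T x | T in A], [set T x | T in B]) => /=.
    by split; [apply: filterS FA|apply: filterS FB] => T ?; exists T.
  move=> [_ _]/= [[S AS <-] [T BT <-]].
  have := AB (S, T) (conj AS BT); rewrite /= -!ball_normE/= => ST.
  rewrite (_ : S x - T x = (S - T) x)// (le_lt_trans (nest_opnormP _ _))// -nest_normE.
  rewrite (le_lt_trans (y := `|S - T| * (`|x| + 1)))//.
    by rewrite ler_wpM2l// lerDl ler01.
  by rewrite -ltr_pdivlMr// ltr_wpDl// ltr01.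
pose L x := lim ((fun T : nest_algebra => T x) @ F).
have LF x : (fun T : nest_algebra => T x) @ F --> L x by exact: evalC.
have lL : linear L.
  move=> a x y.
  apply: (@cvg_lim _ (@norm_hausdorff _ _) _ F _
    (fun T : nest_algebra => T (a *: x + y))).
  rewrite (_ : (fun T : nest_algebra => T (a *: x + y)) =
     ((a \*: (fun T : nest_algebra => T x)) + (fun T : nest_algebra => T y))).
    by apply: cvgD => //; exact: cvgZl_tmp.
  by apply/funext => T; rewrite nest_linear.
have LT (e : R) : 0 < e ->
      F [set T : nest_algebra | forall x, `|T x - L x| <= e%:C * `|x|].
  move=> e0; have e1 : (0 : C) < e%:C by rewrite ltcR.
  have [[A B]/= [FA FB] AB] := FC _ e1.
  near=> T => x.
  have AT : A T by near: T.
  apply/ler_addgt0Pr => d d0.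
  have [S [BS Sd]] : exists S, B S /\ `|L x - S x| < d.
    apply: (@filter_ex _ F); near=> S; split; first by near: S.
    by near: S; move/cvgrPdist_lt : (LF x); exact.
  have := AB (T, S) (conj AT BS); rewrite /= -ball_normE/= => ST.
  rewrite (_ : T x - L x = (T - S) x + (S x - L x)); last first.
    by rewrite [(T - S) x]/= addrA subrK.
  rewrite (le_trans (ler_normD _ _))// lerD//.
    by rewrite (le_trans (nest_opnormP _ _))// ler_wpM2r// ltW.
  by rewrite distrC ltW.
have LP : L \in nest_operator.
  apply/asboolP; split => //; last first.
    move=> M NM _ [x Mx <-]; have [_ _ cM] := nest_closed_subspace NM.
    apply: (closed_cvg _ cM _ _ (LF x)); apply: nearW => T.
    by apply: (nest_stable NM); exists x.
  have [T TL] := filter_ex (LT 1 ltr01).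
  apply: (@continuous_of_bounded L (opnorm T + 1)) => // x.
  rewrite -[L x](subrK (T x)) (le_trans (ler_normD _ _))// addrC distrC.
  by rewrite CD mulrDl lerD// nest_opnormP.
apply/cvg_ex; exists (NestOperator LP).
apply/cvgrPdist_le => /= e e0.
have eE : e = (complex.Re e)%:C by rewrite RRe_real// gtr0_real.
have e'0 : 0 < complex.Re e by rewrite -ltcR -eE.
apply: filterS (LT _ e'0) => T TL.
rewrite nest_normE eE lecR nest_opnorm_le// ?ltW// => x.
by rewrite distrC in TL *; exact: TL.
Unshelve. all: by end_near.
Qed.
HB.instance Definition _ :=
  Uniform_isComplete.Build nest_algebra nest_algebra_complete.

Fact nest_operator_id : (idfun : H -> H) \in nest_operator.
Proof.
by apply/asboolP; split => [//|x|M NM _ [x Mx <-]//]; exact: cvg_id.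
Qed.

Fact nest_operator_comp S T : (S \o T : H -> H) \in nest_operator.
Proof.
apply/asboolP; split => [a x y|x|M NM _ [x Mx <-]] /=.
- by rewrite !nest_linear.
- by apply: continuous_comp; exact: nest_continuous.
- by apply: (nest_stable NM); exists (T x) => //; apply: (nest_stable NM); exists x.
Qed.

Definition nest_one : nest_algebra := NestOperator nest_operator_id.
Definition nest_mul S T : nest_algebra := NestOperator (nest_operator_comp S T).

Local Lemma nmulA : associative nest_mul. Proof. by move=> S T U; exact/val_inj. Qed.
Local Lemma nmul1 : left_id nest_one nest_mul. Proof. by move=> T; exact/val_inj. Qed.
Local Lemma nmulr1 : right_id nest_one nest_mul. Proof. by move=> T; exact/val_inj. Qed.
Local Lemma nmulDl : left_distributive nest_mul +%R.
Proof. by move=> S T U; exact/val_inj. Qed.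
Local Lemma nmulDr : right_distributive nest_mul +%R.
Proof.
by move=> S T U; apply/val_inj/funext => x /=; rewrite linearDf//; exact: nest_linear.
Qed.
Local Lemma nscaleAl (k : C) S T : k *: nest_mul S T = nest_mul (k *: S) T.
Proof. exact/val_inj. Qed.
Local Lemma nscaleAr (k : C) S T : k *: nest_mul S T = nest_mul S (k *: T).
Proof.
by apply/val_inj/funext => x /=; rewrite linearZf//; exact: nest_linear.
Qed.
Local Lemma nnormM S T : `|nest_mul S T| <= `|S| * `|T|.
Proof.
rewrite !nest_normE -CM lecR nest_opnorm_le ?mulr_ge0// => x.
by apply: (le_trans (nest_opnormP S (T x))); rewrite CM -mulrA ler_wpM2l ?ler0c.
Qed.
HB.instance Definition _ := CompleteNormedModule_isBanachAlgebra.Build C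
  nest_algebra nmulA nmul1 nmulr1 nmulDl nmulDr nscaleAl nscaleAr nnormM.

End NestAlgebra.

(* Main.v *)
(* A chain in the nest with successive differences F_0, F_1, ..., F_0 being the topmost
   and the dimensions nondecreasing, carries an n-ary tree of partial isometries
   A_t : F_k -> F_(n k + t + 1), t < n. Put D_k = F_k + F_(k+1) + ... + (bottom of the
   chain). Modulo D_(n k + 1), the row A is isometric on n-tuples from
   F_0 + ... + F_(k-1). If S is within 1 / (4 n) of A, if S B = 1, and if h is a nonzero
   vector of F_0, then the sum p_k of the distances of the B_t h to D_k satisfies
   p_1 >= 4 n |h| and p_k <= n |h| + p_(n k + 1) / 4, so that it at least doubles from
   one level of the tree to the next, whereas it is at most the sum of the |B_t h|:
   the height of the tree is bounded in terms of B. To exclude every B at once, A is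
   built from trees of all heights living on pairwise disjoint intervals of the nest;
   such intervals are found by repeatedly cutting a long chain in the middle, as one of
   the two parts of the nest must still contain chains of every length. *)

Require Import Defs.
From HB Require Import structures.
From mathcomp Require Import all_boot all_order all_algebra complex.
From mathcomp Require Import all_classical all_reals all_analysis.
From mathcomp Require Import finmap lra ring summability.

Set Implicit Arguments.
Unset Strict Implicit.
Unset Printing Implicit Defensive.

Import Order.TTheory GRing.Theory Num.Theory.
Import numFieldNormedType.Exports.

Local Open Scope classical_set_scope.
Local Open Scope ring_scope.

(** * Real-valued norm, Cauchy-Schwarz inequality, continuity of the inner product *)

Section HilbertNorm.
Variables (R : realType) (H : hilbertType R).
Implicit Types (x y z : H) (a : R[i]) (M L : set H).

(** The norm of [H] has values in [R[i]]; its real part gives access to suprema, square roots and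
    the total order of [R]. *)
Definition hnorm x : R := complex.Re `|x|.

Lemma hnormE x : `|x| = (hnorm x)%:C%C.
Proof. by rewrite RRe_real// normr_real. Qed.

Lemma hnorm_ge0 x : 0 <= hnorm x.
Proof. by rewrite -ler0c -hnormE. Qed.

Lemma hnorm0 : hnorm 0 = 0.
Proof. by rewrite /hnorm normr0. Qed.

Lemma hnorm_eq0 x : hnorm x = 0 -> x = 0.
Proof. by move=> x0; apply/eqP; rewrite -normr_eq0 hnormE x0. Qed.

Lemma hnormN x : hnorm (- x) = hnorm x.
Proof. by rewrite /hnorm normrN. Qed.

Lemma ler_hnormD x y : hnorm (x + y) <= hnorm x + hnorm y.
Proof. by rewrite -lecR rmorphD/= -!hnormE ler_normD. Qed.

Lemma hnorm_sqr x : (hnorm x ^+ 2)%:C%C = inner x x.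
Proof. by rewrite rmorphXn/= -hnormE normr_inner. Qed.

Lemma hnormZ a x : hnorm (a *: x) = complex.Re `|a| * hnorm x.
Proof. by apply: complexI; rewrite rmorphM/= -!hnormE normrZ. Qed.

Lemma innerC x y : inner x y = (inner y x)^*%R.
Proof. by rewrite hermC /= expr0 mul1r. Qed.

Lemma innerZl a x y : inner (a *: x) y = a * inner x y.
Proof. by rewrite linearZl_LR. Qed.

Lemma innerZr a x y : inner x (a *: y) = a^* * inner x y.
Proof. by rewrite linearZr_LR. Qed.

Lemma inner_sym0 x y : inner x y = 0 -> inner y x = 0.
Proof. by move=> xy; rewrite innerC xy conjC0. Qed.

Lemma hnorm_sqrDd x y : inner x y = 0 ->
  hnorm (x + y) ^+ 2 = hnorm x ^+ 2 + hnorm y ^+ 2.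
Proof.
by move=> xy; apply: complexI; rewrite rmorphD/= !hnorm_sqr hnormDd.
Qed.

Lemma parallelogram x y :
  hnorm (x + y) ^+ 2 + hnorm (x - y) ^+ 2 = 2 * hnorm x ^+ 2 + 2 * hnorm y ^+ 2.
Proof.
apply: complexI; rewrite !mulr_natl !mulr2n !rmorphD/= !hnorm_sqr.
rewrite dnormD dnormB; ring.
Qed.

(* The optimal a in the inequality |x - a y|^2 >= 0 is <x, y> / <y, y>. *)
Lemma hnorm_sqrB_proj x y : y != 0 ->
  (hnorm (x - (inner x y / inner y y) *: y) ^+ 2)%:C%C =
  inner x x - `|inner x y| ^+ 2 / inner y y.
Proof.
move=> y0; have yy0 : inner y y != 0 by rewrite dnorm_eq0.
rewrite hnorm_sqr !linearBl !linearBr/= !innerZl !innerZr normCK.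
rewrite rmorphM fmorphV/= -(innerC y x) -(innerC y y).
by field.
Qed.

Lemma cauchy_schwarz x y : `|inner x y| <= `|x| * `|y|.
Proof.
have [->|y0] := eqVneq y 0; first by rewrite linear0r normr0 normr0 mulr0.
rewrite -ler_sqr ?nnegrE ?mulr_ge0// exprMn !normr_inner.
rewrite -ler_pdivrMr ?dnorm_gt0// -subr_ge0 -hnorm_sqrB_proj//.
by rewrite ler0c sqr_ge0.
Qed.

Lemma inner_continuous y : continuous (inner^~ y : H -> R[i]^o).
Proof.
have lf : linear (inner^~ y : H -> R[i]^o).
  by move=> a u v /=; rewrite linearDl linearZl_LR.
pose m := GRing.isLinear.Build _ _ _ _ (inner^~ y : H -> R[i]^o) lf.
pose g : {linear H -> R[i]^o} := HB.pack (inner^~ y : H -> R[i]^o) m.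
apply: (@bounded_linear_continuous _ _ _ g).
apply/linear_boundedP; exists `|y|; split; first exact: normr_real.
move=> r yr x; rewrite (le_trans (cauchy_schwarz x y))// mulrC.
by rewrite ler_wpM2r// ltW.
Qed.

(** With this, orthogonality passes from generators to closed spans and from terms to limits of
    sums. *)
Lemma closed_subspace_ortho y : closed_subspace [set x | inner x y = 0].
Proof.
split=> [|a u v /= u0 v0|]; first exact: linear0l.
  by rewrite linearDl linearZl_LR/= u0 v0 mulr0 addr0.
apply: (@closed_comp _ _ (inner^~ y : H -> R[i]^o) [set 0]).
  by move=> x _; exact: inner_continuous.
exact: (accessible_closed_set1 (hausdorff_accessible (@norm_hausdorff _ _))).
Qed.

End HilbertNorm.

(** * Closure properties of closed subspaces *)

Section ClosedSubspace.
Variables (R : realType) (H : hilbertType R) (M : set H).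
Hypothesis Mc : closed_subspace M.

Lemma closed_subspace0 : M 0. Proof. by case: Mc. Qed.

Lemma closed_subspaceD x y : M x -> M y -> M (x + y).
Proof. by case: Mc => _ MD _ Mx My; rewrite -[x]scale1r; exact: MD. Qed.

Lemma closed_subspaceZ a x : M x -> M (a *: x).
Proof.
by case: Mc => M0 MD _ Mx; rewrite -[_ *: _]addr0; exact: MD.
Qed.

Lemma closed_subspaceB x y : M x -> M y -> M (x - y).
Proof.
by move=> Mx My; apply: closed_subspaceD => //; rewrite -scaleN1r; exact: closed_subspaceZ.
Qed.

Lemma closed_subspace_sum (I : Type) (r : seq I) (P : pred I) (F : I -> H) :
  (forall i, P i -> M (F i)) -> M (\sum_(i <- r | P i) F i).
Proof.
move=> MF; elim/big_ind : _ => //; [exact: closed_subspace0|exact: closed_subspaceD].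
Qed.

End ClosedSubspace.

(** * Closest points and orthogonal projections *)

Section HilbertConvergence.
Variables (R : realType) (H : hilbertType R).
Implicit Types (x y z : H) (M L : set H).

Lemma hnorm_lt x (e : R[i]) : 0 < e -> hnorm x < complex.Re e -> `|x| < e.
Proof.
move=> e0 xe; rewrite hnormE (_ : e = (complex.Re e)%:C%C) ?ltcR//.
by rewrite RRe_real// gtr0_real.
Qed.

Lemma Re_gt0 (e : R[i]) : 0 < e -> 0 < complex.Re e.
Proof. by rewrite ltcE => /andP[]. Qed.

Lemma cvg_of_hnorm_cauchy (F : set_system H) : ProperFilter F ->
  (forall e : R, 0 < e -> exists x, F [set y | hnorm (x - y) < e]) -> cvg F.
Proof.
move=> FF FC; apply: cauchy_cvg; apply: cauchy_exP => e e0.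
have [x Fx] := FC _ (Re_gt0 e0); exists x.
by apply: filterS Fx => y xy; rewrite -ball_normE/=; exact: hnorm_lt.
Qed.

Lemma ler_hnorm_dist x y : `|hnorm x - hnorm y| <= hnorm (x - y).
Proof.
have h (a b : H) : hnorm a <= hnorm (a - b) + hnorm b.
  by rewrite -{1}(subrK b a) ler_hnormD.
have := h y x; rewrite -(hnormN (y - x)) opprB => hyx.
by have := h x y; rewrite ler_norml => hxy; apply/andP; split; lra.
Qed.

Lemma hnorm_continuous : continuous (@hnorm R H : H -> R^o).
Proof.
move=> x; apply/cvgrPdist_lt => /= e e0.
have e1 : (0 : R[i]) < e%:C%C by rewrite ltcR.
near=> y.
rewrite (le_lt_trans (ler_hnorm_dist _ _))// -ltcR -hnormE.
near: y; have /cvgrPdist_lt/(_ _ e1) : (fun z : H => z) @ x --> x by exact: cvg_id.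
exact.
Unshelve. all: by end_near. Qed.

Lemma closed_hnorm_le (c : R) : closed [set x : H | hnorm x <= c].
Proof.
apply: (@closed_comp _ _ (@hnorm R H : H -> R^o) [set r | r <= c]).
  by move=> x _; exact: hnorm_continuous.
exact: closed_le.
Qed.

Lemma closed_hnorm_ge (c : R) : closed [set x : H | c <= hnorm x].
Proof.
apply: (@closed_comp _ _ (@hnorm R H : H -> R^o) [set r | c <= r]).
  by move=> x _; exact: hnorm_continuous.
exact: closed_ge.
Qed.

(* Vectors of M nearly as close to x as possible form a Cauchy family by the
   parallelogram law. *)
Lemma closest_point M x : closed_subspace M ->
  exists2 m, M m & forall y, M y -> hnorm (x - m) <= hnorm (x - y).
Proof.
move=> Mc; pose S := [set hnorm (x - m) ^+ 2 | m in M].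
have Slb : lbound S 0 by move=> _ [m _ <-]; exact: sqr_ge0.
have Sinf : has_inf S.
  by split; [exists (hnorm (x - 0) ^+ 2), 0 => //; case: Mc|exists 0].
pose d := inf S.
have dle m : M m -> d <= hnorm (x - m) ^+ 2.
  by move=> Mm; apply: ge_inf; [exact: Sinf.2|exists m].
pose B (e : R) := [set m | M m /\ hnorm (x - m) ^+ 2 < d + e].
pose F := filter_from [set e : R | 0 < e] B.
have FF : ProperFilter F.
  apply: filter_from_proper; last first.
    move=> e e0; have [_ [m Mm <-] me] := inf_adherent e0 Sinf.
    by exists m.
  apply: filter_from_filter; first by exists 1; exact: ltr01.
  move=> e f e0 f0; exists (Num.min e f); first by rewrite /= lt_min e0.
  move=> m [Mm md]; split; split=> //; rewrite (lt_le_trans md)// lerD2l.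
    by rewrite ge_min lexx.
  by rewrite ge_min lexx orbT.
(* The sum of [x - m] and [x - m'] is twice the difference of [x] and the midpoint, which lies in
   [M]; its square is at least 4 d, against a total below 4 (d + e). *)
have Bdiam (e : R) m m' : B e m -> B e m' -> hnorm (m - m') ^+ 2 < 4 * e.
  move=> [Mm me] [Mm' me'].
  have h2 : (2%:R : R[i]) != 0 by rewrite pnatr_eq0.
  have := parallelogram (x - m) (x - m').
  have -> : x - m + (x - m') = 2%:R *: (x - 2%:R^-1 *: (m + m')).
    by rewrite scalerBr scalerA divff// scale1r scaler_nat mulr2n opprD addrACA.
  have -> : x - m - (x - m') = - (m - m').
    by rewrite !opprB addrC addrA subrK.
  rewrite hnormN hnormZ exprMn.
  have -> : complex.Re `|2%:R : R[i]| = 2.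
    by rewrite normr_nat -[2%:R](rmorph_nat (real_complex R)).
  have := dle (2%:R^-1 *: (m + m'))
    (closed_subspaceZ Mc _ (closed_subspaceD Mc Mm Mm')).
  move: me me'; set a := hnorm _ ^+ 2; set b := hnorm _ ^+ 2.
  set c := hnorm _ ^+ 2; set f := hnorm _ ^+ 2; lra.
have FBe (e : R) : 0 < e -> F (B e) by move=> e0; exists e.
have /cvg_ex[m Fm] : cvg F.
  apply: cvg_of_hnorm_cauchy => e e0.
  have e4 : 0 < e ^+ 2 / 4 by rewrite divr_gt0 ?exprn_gt0.
  have [m Bm] := filter_ex (FBe _ e4); exists m.
  apply: filterS (FBe _ e4) => m' Bm'.
  have := Bdiam _ _ _ Bm Bm'.
  rewrite mulrC divfK// => /= mm'.
  by rewrite -(ltr_pXn2r (n := 2)) ?nnegrE ?hnorm_ge0 ?(ltW e0).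
have cF (A : set H) : closed A -> F A -> A m.
  by move=> cA FA; apply: (closed_cvg _ cA FA) Fm.
have Mm : M m.
  apply: cF; first by case: Mc.
  by apply: filterS (FBe 1 ltr01) => ? [].
exists m => // y My.
rewrite -(ler_pXn2r (n := 2)) ?nnegrE ?hnorm_ge0//.
apply: (le_trans _ (dle _ My)); apply/ler_addgt0Pr => e e0.
have de : 0 <= d + e by rewrite addr_ge0 ?(ltW e0)// lb_le_inf//; exact: Sinf.1.
rewrite -(sqr_sqrtr de) ler_pXn2r ?nnegrE ?hnorm_ge0 ?sqrtr_ge0//.
have cA : closed [set m | hnorm (x - m) <= Num.sqrt (d + e)].
  apply: (@closed_comp _ _ (fun m => x - m) [set r | hnorm r <= _]).
    by move=> z _; apply: cvgB; [exact: cvg_cst|exact: cvg_id].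
  exact: closed_hnorm_le.
apply: (cF _ cA); apply: filterS (FBe _ e0) => z [_ /ltW zd] /=.
by rewrite -(ler_pXn2r (n := 2)) ?nnegrE ?hnorm_ge0 ?sqrtr_ge0// sqr_sqrtr.
Qed.

(** If [x - m] were not orthogonal to [y], moving the closest point [m] along [y] by the optimal
    coefficient would bring it strictly closer to [x]. *)
Lemma projection_theorem M x : closed_subspace M ->
  exists m, M m /\ forall y, M y -> inner (x - m) y = 0.
Proof.
move=> Mc; have [m Mm mP] := closest_point x Mc; exists m; split=> // y My.
have [->|y0] := eqVneq y 0; first exact: linear0r.
set w := x - m; have := mP (m + (inner w y / inner y y) *: y).
rewrite opprD addrA -/w => /(_ _); rewrite -(ler_pXn2r (n := 2)) ?nnegrE ?hnorm_ge0//.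
rewrite -lecR hnorm_sqrB_proj// hnorm_sqr => wP.
have /wP : M (m + (inner w y / inner y y) *: y).
  by apply: closed_subspaceD => //; exact: closed_subspaceZ.
rewrite lerBrDr gerDl => wy0; apply/eqP.
rewrite -normr_eq0 -sqrf_eq0 eq_le exprn_ge0// andbT.
by rewrite -(ler_pM2r (x := (inner y y)^-1)) ?invr_gt0 ?dnorm_gt0// mul0r.
Qed.

Definition proj M x : H :=
  xget 0 [set m | M m /\ forall y, M y -> inner (x - m) y = 0].

Section Projection.
Variables (M : set H) (Mc : closed_subspace M).

Lemma projP x : M (proj M x) /\ forall y, M y -> inner (x - proj M x) y = 0.
Proof.
rewrite /proj; case: xgetP => [m _ //|nm].
by have [m mP] := projection_theorem x Mc; have := nm m mP.
Qed.

Lemma proj_mem x : M (proj M x). Proof. by case: (projP x). Qed.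

Lemma proj_ortho x y : M y -> inner (x - proj M x) y = 0.
Proof. by case: (projP x) => _; exact. Qed.

Lemma hnorm_sqr_proj x :
  hnorm x ^+ 2 = hnorm (proj M x) ^+ 2 + hnorm (x - proj M x) ^+ 2.
Proof.
have := hnorm_sqrDd (inner_sym0 (proj_ortho x (proj_mem x))).
by rewrite [proj M x + (_ - _)]addrC subrK.
Qed.

Lemma hnormB_proj_le x : hnorm (x - proj M x) <= hnorm x.
Proof.
by rewrite -(ler_pXn2r (n := 2)) ?nnegrE ?hnorm_ge0// [leRHS]hnorm_sqr_proj lerDr sqr_ge0.
Qed.

Lemma proj_unique x m : M m -> (forall y, M y -> inner (x - m) y = 0) -> proj M x = m.
Proof.
move=> Mm mP; apply/eqP; rewrite -subr_eq0 -(dnorm_eq0 (@inner R H)).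
have Md : M (proj M x - m) by apply: closed_subspaceB => //; exact: proj_mem.
rewrite {1}(_ : proj M x - m = (x - m) - (x - proj M x)); last first.
  by rewrite opprB [RHS]addrC addrA subrK.
by rewrite linearBl/= mP// proj_ortho// subrr.
Qed.

Lemma proj_id x : M x -> proj M x = x.
Proof. by move=> Mx; apply: proj_unique => // y _; rewrite subrr linear0l. Qed.

Lemma proj_linear : linear (proj M).
Proof.
move=> a x y; apply: proj_unique => [|z Mz].
  by apply: closed_subspaceD => //; [apply: closed_subspaceZ => //|]; exact: proj_mem.
rewrite opprD addrACA -scalerBr linearDl/= innerZl.
by rewrite !proj_ortho// mulr0 addr0.
Qed.

End Projection.

End HilbertConvergence.

(** * Sums of operators with mutually orthogonal ranges *)

Section OrthogonalSum.
Variables (R : realType) (H : hilbertType R).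

Lemma hnorm_sqr_sum (I : eqType) (s : seq I) (w : I -> H) : uniq s ->
  (forall i j, i != j -> inner (w i) (w j) = 0) ->
  hnorm (\sum_(i <- s) w i) ^+ 2 = \sum_(i <- s) hnorm (w i) ^+ 2.
Proof.
move=> us ow; elim: s us => [|i s IHs]/=; first by rewrite !big_nil hnorm0 expr0n.
move=> /andP[si us]; rewrite !big_cons hnorm_sqrDd ?IHs//.
rewrite linear_sumr big_seq big1//= => j js; apply: ow.
by apply: contraNneq si => ->.
Qed.

(** Each [w i] is the component of [x] in its own direction, so [x] minus the sum of the [w i] is
    orthogonal to that sum, and Pythagoras applies. *)
Lemma bessel (I : eqType) (s : seq I) (x : H) (w : I -> H) : uniq s ->
  (forall i j, i != j -> inner (w i) (w j) = 0) ->
  (forall i, inner (x - w i) (w i) = 0) ->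
  \sum_(i <- s) hnorm (w i) ^+ 2 <= hnorm x ^+ 2.
Proof.
move=> us ow wx; rewrite -hnorm_sqr_sum//; set y := \sum_(i <- s) w i.
have xy : inner (x - y) y = 0.
  rewrite {2}/y linear_sumr big_seq big1//= => i si.
  rewrite /y (big_rem i)//= opprD addrA linearBl/= wx sub0r.
  rewrite linear_sumlz big_seq big1 ?oppr0// => j; rewrite mem_rem_uniq//.
  by rewrite inE => /andP[ji _]; exact: ow.
by rewrite -[in leRHS](subrK y x) hnorm_sqrDd// lerDr sqr_ge0.
Qed.

Variables (I : choiceType) (T : I -> H -> H).
Hypothesis T_linear : forall i, linear (T i).
Hypothesis T_ortho : forall i j x y, i != j -> inner (T i x) (T j y) = 0.
Hypothesis T_bessel : forall x (s : seq I), uniq s ->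
  \sum_(i <- s) hnorm (T i x) ^+ 2 <= hnorm x ^+ 2.

Let S (x : H) (A : {fset I}) : H := \sum_(i <- A) T i x.

Local Instance totally_proper : ProperFilter (@totally I) := totally_filter.

Let totally_ge (A : {fset I}) : totally [set B : {fset I} | (A `<=` B)%fset].
Proof. by exists A. Qed.

Let hnorm_sqr_S x A : hnorm (S x A) ^+ 2 = \sum_(i <- A) hnorm (T i x) ^+ 2.
Proof. by apply: hnorm_sqr_sum => // i j; exact: T_ortho. Qed.

Let sum_fset_split (V : zmodType) (f : I -> V) (A B : {fset I}) : (A `<=` B)%fset ->
  \sum_(i <- B) f i = \sum_(i <- A) f i + \sum_(i <- B | i \notin A) f i.
Proof.
move=> /fsubsetP AB; rewrite (bigID (mem A))/=; congr (_ + _).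
rewrite -big_filter; apply: perm_big; apply: uniq_perm => //.
  by rewrite filter_uniq.
by move=> i; rewrite mem_filter andb_idr//; exact: AB.
Qed.

(** The finite sums of squares are bounded by Bessel; past a finite set where they come within e^2
    of their supremum, the remaining terms have a sum of norm less than e. *)
Let cvg_S x : cvg (S x @ totally).
Proof.
pose E := [set \sum_(i <- A) hnorm (T i x) ^+ 2 | A in [set: {fset I}]].
have Esup : has_sup E.
  split; first by exists (\sum_(i <- fset0) hnorm (T i x) ^+ 2), fset0.
  by exists (hnorm x ^+ 2) => _ [A _ <-]; exact: T_bessel.
apply: cvg_of_hnorm_cauchy => e e0.
have e2 : 0 < e ^+ 2 by rewrite exprn_gt0.
have [_ [A _ <-] Ae] := sup_adherent e2 Esup.
exists (S x A); apply: filterS (totally_ge A) => B /= AB.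
rewrite -hnormN opprB /S (sum_fset_split _ AB) addrC addKr.
rewrite -(ltr_pXn2r (n := 2)) ?nnegrE ?hnorm_ge0 ?(ltW e0)//.
rewrite -big_filter hnorm_sqr_sum ?filter_uniq// ?big_filter; last first.
  by move=> i j; exact: T_ortho.
have : \sum_(i <- B) hnorm (T i x) ^+ 2 <= sup E.
  by apply: ub_le_sup; [exact: Esup.2|exists B].
rewrite (sum_fset_split _ AB); set a := \sum_(i <- A) _; set b := \sum_(i <- B | _) _.
move: Ae; rewrite -/a; lra.
Qed.

(** [U] is the pointwise limit of the finite partial sums. The clauses pass to the limit because
    closed subspaces and norm bounds are closed conditions; the last two together identify the
    squared norm of [U x] as a supremum. *)
Lemma orthogonal_sum : exists U : H -> H,
  [/\ linear U,
      forall L x, closed_subspace L -> (forall i, L (T i x)) -> L (U x),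
      forall L x i, closed_subspace L -> (forall j, j != i -> L (T j x)) ->
        L (U x - T i x),
      forall x (s : seq I), uniq s ->
        \sum_(i <- s) hnorm (T i x) ^+ 2 <= hnorm (U x) ^+ 2
    & forall x c, (forall s : seq I, uniq s -> \sum_(i <- s) hnorm (T i x) ^+ 2 <= c) ->
        hnorm (U x) ^+ 2 <= c].
Proof.
have cS x := cvg_S x.
exists (fun x => lim (S x @ totally)); split.
- move=> a x y; apply: (@cvg_lim _ (@norm_hausdorff _ _)).
  rewrite (_ : S _ = (a \*: S x) + S y); last first.
    apply/funext => A; rewrite /S [RHS]/= [X in _ = X + _]scaler_sumr -big_split/=.
    by apply: eq_bigr => i _; rewrite T_linear.
  by apply: cvgD; [apply: cvgZl_tmp|]; exact: cS.
- move=> L x Lc LT; have [_ _ cL] := Lc; apply: (closed_cvg _ cL _ _ (cS x)).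
  by apply: nearW => A; apply: closed_subspace_sum.
- move=> L x i Lc LT; have [_ _ cL] := Lc.
  have cB : (fun A => S x A - T i x) @ totally --> lim (S x @ totally) - T i x.
    by apply: cvgB; [exact: cS|exact: cvg_cst].
  apply: (closed_cvg _ cL _ _ cB); apply: filterS (totally_ge [fset i]%fset) => A /= iA.
  rewrite /S (sum_fset_split _ iA) big_seq_fset1 addrC addKr.
  by apply: closed_subspace_sum => // j; rewrite inE; exact: LT.
- move=> x s us; have cA := @closed_hnorm_ge _ H (Num.sqrt (\sum_(i <- s) hnorm (T i x) ^+ 2)).
  have s0 : 0 <= \sum_(i <- s) hnorm (T i x) ^+ 2 by rewrite sumr_ge0// => i _; exact: sqr_ge0.
  rewrite -[leLHS](sqr_sqrtr s0) ler_pXn2r ?nnegrE ?hnorm_ge0 ?sqrtr_ge0//.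
  apply: (closed_cvg _ cA _ _ (cS x)).
  apply: filterS (totally_ge (seq_fset tt s)) => A /= sA.
  rewrite -(ler_pXn2r (n := 2)) ?nnegrE ?hnorm_ge0 ?sqrtr_ge0// sqr_sqrtr//.
  rewrite hnorm_sqr_S (sum_fset_split _ sA).
  rewrite (perm_big (seq_fset tt s)) /=; last first.
    by apply: uniq_perm => // i; rewrite -[RHS]/(i \in seq_fset tt s) seq_fsetE.
  by rewrite lerDl sumr_ge0// => i _; exact: sqr_ge0.
- move=> x c xc; have c0 : 0 <= c by have := xc [::] isT; rewrite big_nil.
  rewrite -[leRHS](sqr_sqrtr c0) ler_pXn2r ?nnegrE ?hnorm_ge0 ?sqrtr_ge0//.
  apply: (closed_cvg _ (@closed_hnorm_le _ H (Num.sqrt c)) _ _ (cS x)).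
  apply: nearW => A /=.
  rewrite -(ler_pXn2r (n := 2)) ?nnegrE ?hnorm_ge0 ?sqrtr_ge0// sqr_sqrtr//.
  by rewrite hnorm_sqr_S; exact: xc.
Qed.

End OrthogonalSum.

(** * Partial isometries from comparisons of dimensions *)

Section PartialIsometry.
Variables (R : realType) (H : hilbertType R).
Implicit Types (x y : H) (M L K E F : set H) (V : H -> H).

Lemma closed_span_sub E M : closed_subspace M -> E `<=` M -> closed_span E `<=` M.
Proof. by move=> Mc EM x; apply. Qed.

Lemma sub_closed_span E : E `<=` closed_span E.
Proof. by move=> x Ex M [_]; exact. Qed.

Lemma closed_subspace_bigcap (G : set (set H)) :
  (forall M, G M -> closed_subspace M) -> closed_subspace (\bigcap_(M in G) M).
Proof.
move=> Gc; split=> [M GM|a x y Mx My M GM|].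
- by case: (Gc _ GM).
- by have [_ MD _] := Gc _ GM; apply: MD; [exact: Mx|exact: My].
- by apply: closed_bigI => M /Gc[].
Qed.

Lemma closed_subspace_span E : closed_subspace (closed_span E).
Proof. by apply: closed_subspace_bigcap => M []. Qed.

(** For a closed subspace [M], the norm equation says both that [V] is isometric on [M] and that it
    vanishes on the orthogonal complement. *)
Definition partial_isometry V M L :=
  [/\ linear V, forall x, L (V x) & forall x, hnorm (V x) = hnorm (proj M x)].

Lemma partial_isometry_comp V W M L K : closed_subspace L ->
  partial_isometry V M L -> partial_isometry W L K -> partial_isometry (W \o V) M K.
Proof.
move=> Lc [lV LV nV] [lW KW nW]; split=> [a x y||x] //=; first by rewrite lV lW.
by rewrite nW proj_id.
Qed.

Lemma partial_isometry_proj M : closed_subspace M -> partial_isometry (proj M) M M.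
Proof. by move=> Mc; split=> //; [exact: proj_linear|exact: proj_mem]. Qed.

Section BasisSum.
Variables (E F : set H) (f : H -> H).
Hypothesis E1 : forall x, E x -> inner x x = 1.
Hypothesis E0 : forall x y, E x -> E y -> x <> y -> inner x y = 0.
Hypothesis fF : forall e, E e -> F (f e).
Hypothesis F1 : forall x, F x -> inner x x = 1.
Hypothesis F0 : forall x y, F x -> F y -> x <> y -> inner x y = 0.
Hypothesis f_inj : forall x y, E x -> E y -> f x = f y -> x = y.

Let T e x : H := if `[< E e >] then inner x e *: f e else 0.

Let T_norm e x : hnorm (T e x) = if `[< E e >] then complex.Re `|inner x e| else 0.
Proof.
rewrite /T; case: asboolP => [Ee|_]; last exact: hnorm0.
rewrite hnormZ (_ : hnorm (f e) = 1) ?mulr1//; apply/eqP.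
rewrite -sqrp_eq1 ?hnorm_ge0//; apply/eqP/complexI.
by rewrite hnorm_sqr F1//; exact: fF.
Qed.

Lemma basis_bessel x (s : seq H) : uniq s ->
  \sum_(e <- s) (if `[< E e >] then complex.Re `|inner x e| else 0) ^+ 2
    <= hnorm x ^+ 2.
Proof.
move=> us; pose w e := if `[< E e >] then inner x e *: e else 0.
have -> : \sum_(e <- s) (if `[< E e >] then complex.Re `|inner x e| else 0) ^+ 2 =
    \sum_(e <- s) hnorm (w e) ^+ 2.
  apply: eq_bigr => e _; rewrite /w; case: asboolP => [Ee|_]; last by rewrite hnorm0.
  rewrite hnormZ (_ : hnorm e = 1) ?mulr1//; apply/eqP.
  by rewrite -sqrp_eq1 ?hnorm_ge0//; apply/eqP/complexI; rewrite hnorm_sqr E1.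
apply: bessel => // [e e' /eqP ee'|e]; rewrite /w.
  case: asboolP => [Ee|_]; last by rewrite linear0l.
  case: asboolP => [Ee'|_]; last by rewrite linear0r.
  by rewrite innerZl innerZr (E0 Ee Ee' ee') !mulr0.
case: asboolP => [Ee|_]; last by rewrite linear0r.
by rewrite linearBl/= innerZr innerZl innerZr (E1 Ee) mulr1 mulrC subrr.
Qed.

(** [V] is the sum over [e] in [E] of the maps sending [x] to [inner x e *: f e]. The last clause
    determines the norm of [V x] by [E] alone, so different injections [f] give the same norms. *)
Lemma basis_sum : exists V, [/\ linear V,
    forall x L, closed_subspace L -> F `<=` L -> L (V x),
    forall x e, E e -> inner (V x) (f e) = inner x e
  & forall x c, (forall s : seq H, uniq s ->
      \sum_(e <- s) (if `[< E e >] then complex.Re `|inner x e| else 0) ^+ 2 <= c) <->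
      hnorm (V x) ^+ 2 <= c].
Proof.
have [||x s us|V [lV VL VB Vge Vle]] := @orthogonal_sum _ H _ T.
- move=> e a x y; rewrite /T; case: asboolP => [Ee|_]; last by rewrite scaler0 addr0.
  by rewrite linearDl/= innerZl scalerDl scalerA.
- move=> e e' x y /eqP ee'; rewrite /T.
  case: asboolP => [Ee|_]; last by rewrite linear0l.
  case: asboolP => [Ee'|_]; last by rewrite linear0r.
  have fee' : f e <> f e' by move/(f_inj Ee Ee').
  by rewrite innerZl innerZr (F0 (fF Ee) (fF Ee') fee') !mulr0.
- by under eq_bigr do rewrite T_norm; exact: basis_bessel.
exists V; split=> //.
- move=> x L Lc FL; apply: VL => // e; rewrite /T; case: asboolP => [Ee|_].
    by apply: closed_subspaceZ => //; apply/FL/fF.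
  exact: closed_subspace0.
- move=> x e Ee; have : inner (V x - T e x) (f e) = 0.
    apply: (VB [set v | inner v (f e) = 0]); first exact: closed_subspace_ortho.
    move=> e' /eqP ee' /=; rewrite /T; case: asboolP => [Ee'|_]; last by rewrite linear0l.
    have fee' : f e' <> f e by move/(f_inj Ee' Ee).
    by rewrite innerZl (F0 (fF Ee') (fF Ee) fee') mulr0.
  rewrite linearBl/= /T; case: asboolP => // _; rewrite innerZl (F1 (fF Ee)) mulr1.
  by move/eqP; rewrite subr_eq0 => /eqP.
- move=> x c; split=> [xc|xc s us].
    by apply: Vle => s us; under eq_bigr do rewrite T_norm; exact: xc.
  by apply: le_trans xc; under eq_bigr do rewrite -T_norm; exact: Vge.
Qed.

End BasisSum.

(** The basis sum for the injection of bases is the wanted map; the one for the identity of [E] is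
    the projection on [M], and both have the same norms. *)
Lemma hdim_le_partial_isometry M L : hdim_le M L -> exists V, partial_isometry V M L.
Proof.
move=> [E [F [[E1 E0 EM] [F1 F0 FL] /pcard_leP[f]]]].
have fF e : E e -> F (f e) by move=> Ee; exact: funS.
have f_inj x y : E x -> E y -> f x = f y -> x = y.
  by move=> Ex Ey; apply: (@inj _ _ _ f); rewrite in_setE.
have [V [lV VL _ nV]] := basis_sum E1 E0 fF F1 F0 f_inj.
have [//|Q [lQ QM Qe nQ]] := @basis_sum E E id E1 E0 (fun _ => id) E1 E0.
have Mc : closed_subspace M by rewrite -EM; exact: closed_subspace_span.
have EM' : E `<=` M by rewrite -EM; exact: sub_closed_span.
have QE x : proj M x = Q x.
  apply: proj_unique => //; first exact: QM.
  move=> y My; apply: inner_sym0; move: y My; rewrite -EM.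
  apply: closed_span_sub; first exact: closed_subspace_ortho.
  by move=> e Ee /=; apply: inner_sym0; rewrite linearBl/= Qe// subrr.
exists V; split=> // x.
  by apply: VL; rewrite -FL; [exact: closed_subspace_span|exact: sub_closed_span].
apply/eqP; rewrite QE -(eqrXn2 (n := 2)) ?hnorm_ge0// eq_le.
by apply/andP; split; [apply/nV/nQ|apply/nQ/nV].
Qed.

(** Composing isometries avoids transitivity of [hdim_le], which would require that two bases of one
    subspace are equinumerous. *)
Lemma partial_isometry_chain (K : nat -> set H) (a b : nat) : (a <= b)%N ->
  (forall k, closed_subspace (K k)) ->
  (forall k, (a <= k < b)%N -> hdim_le (K k) (K k.+1)) ->
  exists V, partial_isometry V (K a) (K b).
Proof.
move=> ab Kc; elim: b ab => [|b IHb].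
  by rewrite leqn0 => /eqP-> _; exists (proj (K 0)); exact: partial_isometry_proj.
rewrite leq_eqVlt => /predU1P[<- _|ab Kd].
  by exists (proj (K a)); exact: partial_isometry_proj.
have [|V pV] := IHb ab.
  by move=> k /andP[ak kb]; apply: Kd; rewrite ak ltnS ltnW.
have [|W pW] := @hdim_le_partial_isometry (K b) (K b.+1).
  by apply: Kd; rewrite ltnSn andbT.
by exists (W \o V); exact: partial_isometry_comp pW.
Qed.

End PartialIsometry.

(** * Projections on orthogonal differences *)

Section OrthogonalDifference.
Variables (R : realType) (H : hilbertType R).
Implicit Types (x : H) (M L : set H).

Lemma closed_subspace_diff M L :
  closed_subspace M -> closed_subspace (orthogonal_difference M L).
Proof.
move=> Mc; pose G := [set M] `|` [set [set x : H | inner x y = 0] | y in L].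
rewrite (_ : orthogonal_difference M L = \bigcap_(K in G) K).
  apply: closed_subspace_bigcap => _ [->//|[y _ <-]]; exact: closed_subspace_ortho.
apply/seteqP; split=> [x [Mx Lx] _ [->//|[y Ly <-]]|x GM]; first exact: Lx.
by split=> [|y Ly]; [apply: GM; left|apply: (GM [set x | inner x y = 0]); right; exists y].
Qed.

Lemma proj_diff M L x : closed_subspace M -> closed_subspace L -> L `<=` M ->
  proj (orthogonal_difference M L) x = proj M x - proj L x.
Proof.
move=> Mc Lc LM; apply: proj_unique; first exact: closed_subspace_diff.
  split; first by apply: closed_subspaceB => //; [|apply: LM]; exact: proj_mem.
  move=> y Ly; rewrite (_ : _ - _ = (x - proj L x) - (x - proj M x)).
    by rewrite linearBl/= !proj_ortho ?subrr//; exact: LM.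
  by rewrite opprB [RHS]addrC addrA subrK.
move=> y [My Ly]; rewrite opprB addrA addrAC linearDl/= proj_ortho// add0r.
by apply: inner_sym0; apply: Ly; exact: proj_mem.
Qed.

(** Pythagoras, written as a difference so that sums along a chain telescope. *)
Lemma hnorm_sqr_proj_diff M L x : closed_subspace M -> closed_subspace L -> L `<=` M ->
  hnorm (proj (orthogonal_difference M L) x) ^+ 2 =
  hnorm (proj M x) ^+ 2 - hnorm (proj L x) ^+ 2.
Proof.
move=> Mc Lc LM; have := hnorm_sqr_proj Mc x.
have -> := hnorm_sqr_proj Lc x; rewrite proj_diff//.
have o : inner (proj M x - proj L x) (x - proj M x) = 0.
  apply/inner_sym0/proj_ortho => //; apply: closed_subspaceB => //; first exact: proj_mem.
  by apply: LM; exact: proj_mem.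
have := hnorm_sqrDd o; rewrite [proj M x - _ + _]addrC addrA subrK => ->.
by move=> h; lra.
Qed.

End OrthogonalDifference.

(** * The row of tree shifts in the nest algebra *)

Section Shifts.
Variables (R : realType) (H : hilbertType R) (N : nest H) (n : nat).
(** [D r] descends along the tower [r] from its top [D r 0]; the dimensions of its first [q r]
    blocks are nondecreasing. *)
Variables (D : nat -> nat -> set H) (q : nat -> nat).
Local Notation F r k := (orthogonal_difference (D r k) (D r k.+1)).
Hypothesis DN : forall r k, nest_set N (D r k).
Hypothesis DS : forall r k, D r k.+1 `<=` D r k.
Hypothesis Dsep : forall r s, r != s ->
  (forall k, D r 0 `<=` D s k) \/ (forall k, D s 0 `<=` D r k).
Hypothesis Ddim : forall r k, (k.+1 < q r)%N -> hdim_le (F r k) (F r k.+1).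

Let Dc r k : closed_subspace (D r k).
Proof. exact: nest_closed_subspace (DN r k). Qed.

Let Fc r k : closed_subspace (F r k).
Proof. exact: closed_subspace_diff. Qed.

Let DSS r j k : (j <= k)%N -> D r k `<=` D r j.
Proof.
elim: k => [|k IHk]; first by rewrite leqn0 => /eqP->.
rewrite leq_eqVlt => /predU1P[->//|jk].
by apply: subset_trans (IHk jk); exact: DS.
Qed.

(** Within a tower, the deeper block lies in the subspace removed from the other one; of two towers,
    one lies below every member of the other. *)
Let F_ortho (e e' : nat * nat) x y : e != e' -> F e.1 e.2 x -> F e'.1 e'.2 y ->
  inner x y = 0.
Proof.
case: e e' => [r j] [r' j'] ee' [/= Dx ox] [/= Dy oy].
have [rr'|rr'] := eqVneq r r'.
  rewrite -{r'}rr' in ee' Dy oy *; have : j != j' by apply: contraNneq ee' => ->.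
  rewrite neq_ltn => /orP[] jj'; first by apply: ox; exact: DSS Dy.
  by apply: inner_sym0; apply: oy; exact: DSS Dx.
have Dx0 := DSS (leq0n _) Dx; have Dy0 := DSS (leq0n _) Dy.
have [rs|sr] := Dsep rr'; last by apply: ox; exact: sr.
by apply: inner_sym0; apply: oy; exact: rs.
Qed.

(* For t < n these maps have disjoint ranges, as in the n-ary tree whose node j
   has the children n j + 1, ..., n j + n. *)
Let child t j := (n * j + t).+1.

Let child_inj t t' j j' : (t < n)%N -> (t' < n)%N ->
  child t j = child t' j' -> t = t' /\ j = j'.
Proof.
move=> tn t'n [e].
have n0 : (0 < n)%N by case: n tn.
have ej : j = j'.
  have := congr1 (divn^~ n) e.
  by rewrite /= !(mulnC n) !divnMDl// !divn_small// !addn0.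
by split=> //; move: e; rewrite ej => /addnI.
Qed.

(** Isometries are composed from block [j] down to its child. If the child falls beyond the tower,
    the zero map is taken, which leaves only the norm inequality. *)
Let block_isometry t (e : nat * nat) : (t < n)%N -> exists V : H -> H,
  [/\ linear V, forall x, F e.1 (child t e.2) (V x),
      forall x, hnorm (V x) <= hnorm (proj (F e.1 e.2) x)
    & (child t e.2 < q e.1)%N ->
      forall x, hnorm (V x) = hnorm (proj (F e.1 e.2) x)].
Proof.
case: e => r j tn /=; have [cq|_] := ltnP (child t j) (q r); last first.
  exists (fun=> 0); split=> // [a x y|x|x].
  - by rewrite scaler0 addr0.
  - exact: closed_subspace0.
  - by rewrite hnorm0 hnorm_ge0.
have [||k /andP[_ kc]|V [lV VF nV]] :=
    @partial_isometry_chain _ _ (fun k => F r k) j (child t j).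
- by rewrite leqW// (leq_trans _ (leq_addr _ _))// leq_pmull//; case: n tn.
- by move=> k; exact: Fc.
- by apply: Ddim; exact: leq_ltn_trans cq.
- by exists V; split=> // x; rewrite nV.
Qed.

Let V (t : 'I_n) (e : nat * nat) : H -> H := projT1 (cid (block_isometry e (ltn_ord t))).

Let V_linear t e : linear (V t e).
Proof. by rewrite /V; case: cid => W []. Qed.

Let V_range (t : 'I_n) e x : F e.1 (child t e.2) (V t e x).
Proof. by rewrite /V; case: cid => W []. Qed.

Let V_le t e x : hnorm (V t e x) <= hnorm (proj (F e.1 e.2) x).
Proof. by rewrite /V; case: cid => W []. Qed.

Let V_isometry (t : 'I_n) e x : (child t e.2 < q e.1)%N ->
  hnorm (V t e x) = hnorm (proj (F e.1 e.2) x).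
Proof. by move=> cq; rewrite /V; case: cid => W /= [_ _ _]; exact. Qed.

Let V_ortho (s t : 'I_n) (e e' : nat * nat) x y : (s, e) != (t, e') ->
  inner (V s e x) (V t e' y) = 0.
Proof.
move=> ne; apply: (@F_ortho (e.1, child s e.2) (e'.1, child t e'.2) _ _ _
  (V_range s e x) (V_range t e' y)).
apply: contraNneq ne => ee'; have /= e1 := congr1 fst ee'.
have [st e2] := child_inj (ltn_ord s) (ltn_ord t) (congr1 snd ee').
rewrite [e]surjective_pairing [e']surjective_pairing e1 e2.
by rewrite (ord_inj st).
Qed.

Let V_bessel t x (s : seq (nat * nat)) : uniq s ->
  \sum_(e <- s) hnorm (V t e x) ^+ 2 <= hnorm x ^+ 2.
Proof.
move=> us; apply: (@le_trans _ _ (\sum_(e <- s) hnorm (proj (F e.1 e.2) x) ^+ 2)).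
  by apply: ler_sum => e _; rewrite ler_pXn2r ?nnegrE ?hnorm_ge0.
apply: bessel => // [e e' ee'|e]; last by apply: proj_ortho => //; exact: proj_mem.
by apply: (F_ortho ee'); exact: proj_mem.
Qed.

Let V0 t r j x : (forall y, F r j y -> inner x y = 0) -> V t (r, j) x = 0.
Proof.
move=> xF; apply: hnorm_eq0; apply/eqP; rewrite eq_le hnorm_ge0 andbT.
rewrite (le_trans (V_le _ _ _))//= (@proj_unique _ _ _ _ x 0) ?hnorm0//.
  exact: closed_subspace0.
by move=> y Fy; rewrite subr0; exact: xF.
Qed.

(** [A t] is the orthogonal sum of the [V t e] over all nodes of all towers. Nodes below [k] have
    children of index at most [n * k], the others have children from [(n * k).+1] on: a cut at depth
    [k] in the domain becomes a cut at depth [(n * k).+1] in the range. *)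
Lemma nest_shifts : exists A : 'I_n -> nest_algebra N,
  [/\ forall t r k x, D r k x -> D r (n * k).+1 (A t x),
      forall t r k z y, D r 0 z -> (forall y, D r k y -> inner z y = 0) ->
        D r (n * k).+1 y -> inner (A t z) y = 0,
      forall t r k z, D r 0 z -> (forall y, D r k y -> inner z y = 0) ->
        (n * k < q r)%N -> hnorm z <= hnorm (A t z)
    & forall s t x y, s != t -> inner (A s x) (A t y) = 0].
Proof.
have US t : exists U : nest_algebra N,
  (forall L x, closed_subspace L -> (forall e, L (V t e x)) -> L (U x)) /\
  (forall x (s : seq (nat * nat)), uniq s ->
     \sum_(e <- s) hnorm (V t e x) ^+ 2 <= hnorm (U x) ^+ 2).
  have [||x s us|U [lU UL _ Uge Ule]] := @orthogonal_sum _ H _ (V t).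
  - by move=> e; exact: V_linear.
  - by move=> e e' x y ee'; apply: V_ortho; apply: contraNneq ee' => -[->].
  - exact: V_bessel.
  suff UN : U \in nest_operator N by exists (NestOperator UN).
  apply/asboolP; split=> // [|M NM _ [x Mx <-]].
    apply: (@Defs.continuous_of_bounded _ _ U 1 lU) => x.
    rewrite mul1r !hnormE lecR -(ler_pXn2r (n := 2)) ?nnegrE ?hnorm_ge0//.
    by apply: Ule => s us; exact: V_bessel.
  apply: UL => [|[r j]]; first exact: nest_closed_subspace NM.
  (* Either [M] is orthogonal to the initial block and is sent to 0, or it contains [D r j.+1] and
     with it the deeper range of the map. *)
  have [MD|DM] := nest_total NM (DN r j.+1).
    rewrite V0; first by apply: closed_subspace0; exact: nest_closed_subspace NM.
    by move=> y [_ yo]; apply: inner_sym0; apply: yo; exact: MD.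
  have [DV _] := V_range t (r, j) x.
  apply: DM; apply: DSS DV; rewrite /= /child ltnS (leq_trans _ (leq_addr _ _))//.
  by rewrite leq_pmull// (leq_ltn_trans (leq0n t)).
have [A /all_and2[AL Age]] := choice US.
exists A; split.
- move=> t r k x Dx; apply: AL => // -[r' j].
  have [DV _] := V_range t (r', j) x.
  have [rr'|rr'] := eqVneq r r'.
    rewrite -{r'}rr' in DV *; have [jk|kj] := ltnP j k.
      rewrite V0; first exact: closed_subspace0.
      by move=> y [_ yo]; apply: inner_sym0; apply: yo; exact: DSS Dx.
    by apply: DSS DV; rewrite /= ltnS (leq_trans _ (leq_addr _ _))// leq_mul2l kj orbT.
  (* A different tower lies either above [D r 0], so that its maps kill [x], or below all [D r k],
     the target included. *)
  have [rs|sr] := Dsep rr'; last by apply: sr; exact: DSS (leq0n _) _ DV.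
  rewrite V0; first exact: closed_subspace0.
  by move=> y [_ yo]; apply: inner_sym0; apply: yo; apply: rs; exact: DSS Dx.
- move=> t r k z y Dz zo Dy; apply: (AL t [set v | inner v y = 0]).
    exact: closed_subspace_ortho.
  move=> [r' j] /=; have [DV oV] := V_range t (r', j) z.
  have [rr'|rr'] := eqVneq r r'.
    rewrite -{r'}rr' in DV oV *; have [jk|kj] := ltnP j k.
      apply: oV; apply: DSS Dy; rewrite /= /child ltnS.
      rewrite (leq_trans _ (_ : n * j.+1 <= _)%N) ?leq_mul2l ?jk ?orbT//.
      by rewrite mulnS [(n + _)%N]addnC ltn_add2l.
    rewrite V0 ?linear0l// => w [Dw _]; apply: zo; exact: DSS Dw.
  rewrite V0 ?linear0l// => w [Dw ow]; have [rs|sr] := Dsep rr'.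
    by apply: inner_sym0; apply: ow; exact: rs.
  by apply: zo; apply: sr; exact: DSS (leq0n _) _ Dw.
- move=> t r k z Dz zo kq.
  rewrite -(ler_pXn2r (n := 2)) ?nnegrE ?hnorm_ge0//.
  (* The children of these nodes have index at most [n * k], inside the tower, so the maps are
     isometric on their blocks; the squares telescope to the full square of [z], whose projection on
     [D r k] is 0. *)
  pose s := [seq (r, j) | j <- index_iota 0 k].
  have us : uniq s by rewrite map_inj_uniq ?iota_uniq// => i j [].
  apply: le_trans (Age t z s us); rewrite big_map.
  rewrite (eq_big_nat _ _ (F2 := fun j =>
      - hnorm (proj (D r j.+1) z) ^+ 2 - - hnorm (proj (D r j) z) ^+ 2)); last first.
    move=> j /andP[_ jk]; rewrite V_isometry/=.
      by rewrite hnorm_sqr_proj_diff// opprK addrC.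
    apply: leq_ltn_trans kq; rewrite /child.
    rewrite (leq_trans _ (_ : n * j.+1 <= _)%N) ?leq_mul2l ?jk ?orbT//.
    by rewrite mulnS [(n + _)%N]addnC ltn_add2l.
  rewrite (@telescope_sumr _ 0 k (fun j => - hnorm (proj (D r j) z) ^+ 2))//.
  rewrite opprK (proj_id (Dc r 0) Dz) (@proj_unique _ _ _ _ z 0)//.
  + by rewrite hnorm0 expr0n oppr0 add0r.
  + exact: closed_subspace0.
  + by move=> y Dy; rewrite subr0; exact: zo.
- move=> s t x y st.
  apply: (AL s [set v | inner v (A t y) = 0]); first exact: closed_subspace_ortho.
  move=> e /=; apply: inner_sym0.
  apply: (AL t [set v | inner v (V s e x) = 0]); first exact: closed_subspace_ortho.
  by move=> e' /=; apply: V_ortho; rewrite eq_sym; apply: contraNneq st => -[->].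
Qed.

End Shifts.

(** * Separated chains of prescribed lengths *)

Section Towers.
Variables (R : realType) (H : hilbertType R) (N : nest H).
Implicit Types (L U C : set H) (M : nat -> set H) (q : nat).

Definition dim_chain q M :=
  [/\ forall j, (j <= q)%N -> nest_set N (M j),
      forall j, (j < q)%N -> M j `<` M j.+1
    & forall j, (1 <= j < q)%N ->
        hdim_le (orthogonal_difference (M j.+1) (M j))
                (orthogonal_difference (M j) (M j.-1))].

Lemma dim_chain_mono q M i j : dim_chain q M -> (i <= j <= q)%N -> M i `<=` M j.
Proof.
move=> [_ Mlt _]; elim: j => [|j IHj]; first by rewrite leqn0 => /andP[/eqP-> _].
move=> /andP[]; rewrite leq_eqVlt => /predU1P[->|ij] jq; first exact: subset_refl.
have [jj1 _] := Mlt _ jq; apply: subset_trans jj1; apply: IHj.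
by rewrite -ltnS ij ltnW.
Qed.

Lemma dim_chain_take a q M : (a <= q)%N -> dim_chain q M -> dim_chain a M.
Proof.
move=> aq [MN Mlt Md]; split=> j.
- by move=> ja; apply: MN; exact: leq_trans aq.
- by move=> ja; apply: Mlt; exact: leq_trans aq.
- by move=> /andP[j1 ja]; apply: Md; rewrite j1 (leq_trans ja).
Qed.

Lemma dim_chain_drop a q M : dim_chain (a + q) M -> dim_chain q (fun j => M (a + j)%N).
Proof.
move=> [MN Mlt Md]; split=> j.
- by move=> ja; apply: MN; rewrite leq_add2l.
- by move=> ja; rewrite addnS; apply: Mlt; rewrite ltn_add2l.
- case: j => // j /= ja; rewrite !addnS; apply: (Md (a + j).+1).
  by rewrite /= -addnS ltn_add2l.
Qed.

Definition rich L U := forall q, exists M,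
  [/\ dim_chain q M, L `<=` M 0 & M q `<=` U].

(** If length [a] failed below [C] and length [b] above it, comparing [C] with the member of index
    [a] in a chain of length [a + b] would give a contradiction. *)
Lemma rich_split L U C : nest_set N C -> rich L U -> rich L C \/ rich C U.
Proof.
move=> NC LU; apply: contrapT => /not_orP[/existsNP[a aLC] /existsNP[b bCU]].
have [M [Mc LM MU]] := LU (a + b)%N.
have [MaC|CMa] := nest_total (let: And3 MN _ _ := Mc in MN a (leq_addr b a)) NC.
  by apply: aLC; exists M; split=> //; exact: dim_chain_take (leq_addr b a) Mc.
apply: bCU; exists (fun j => M (a + j)%N); split=> //; first exact: dim_chain_drop.
by rewrite addn0.
Qed.

(** A chain of length 2 q is cut at its midpoint; one side of the cut stays rich and is kept, and
    the half chain on the other side becomes the tower. *)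
Lemma rich_step L U q : rich L U -> exists M L' U',
  [/\ dim_chain q M, L `<=` M 0 /\ M q `<=` U, rich L' U',
      L `<=` L' /\ U' `<=` U & M q `<=` L' \/ U' `<=` M 0].
Proof.
move=> LU; have [M [Mc LM MU]] := LU (q + q)%N.
have NC : nest_set N (M q) by case: Mc => MN _ _; apply: MN; exact: leq_addr.
have LMq : L `<=` M q.
  by apply: (subset_trans LM); apply: (dim_chain_mono Mc); rewrite leq_addr.
have MqU : M q `<=` U.
  by apply: subset_trans MU; apply: (dim_chain_mono Mc); rewrite leq_addr leqnn.
have [rL|rU] := rich_split NC LU.
  exists (fun j => M (q + j)%N), L, (M q); split=> //.
  - exact: dim_chain_drop.
  - by rewrite addn0.
  - by split=> // x.
  - by right; rewrite addn0 => x.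
exists M, (M q), U; split=> //.
- exact: dim_chain_take (leq_addr q q) Mc.
- by split=> // x.
- by left=> x.
Qed.

(** Iterating the step yields nested intervals. Each tower lies to one side of the interval kept
    after it, and that interval contains all later towers. *)
Lemma separated_towers (q : nat -> nat) :
  (forall p, (0 < p)%N -> exists M, dim_chain p M) ->
  exists M : nat -> nat -> set H, (forall r, dim_chain (q r) (M r)) /\
    forall r s, r != s -> M r (q r) `<=` M s 0 \/ M s (q s) `<=` M r 0.
Proof.
move=> Nc; pose interval := {P : set H * set H | rich P.1 P.2}.
(* Only positive lengths are given, so length 0 is obtained by truncating a chain of length 1. *)
have rich0 : rich [set 0] setT.
  move=> p; have [M Mc] := Nc p.+1 isT; exists M; split=> //.
    exact: dim_chain_take (leqnSn p) Mc.
  move=> _ ->; have [MN _ _] := Mc.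
  by case: (nest_closed_subspace (MN 0 isT)).
have step (rP : nat * interval) : exists MP : (nat -> set H) * interval,
    [/\ dim_chain (q rP.1) MP.1,
        (sval rP.2).1 `<=` MP.1 0 /\ MP.1 (q rP.1) `<=` (sval rP.2).2,
        (sval rP.2).1 `<=` (sval MP.2).1 /\ (sval MP.2).2 `<=` (sval rP.2).2
      & MP.1 (q rP.1) `<=` (sval MP.2).1 \/ (sval MP.2).2 `<=` MP.1 0].
  case: rP => r [[L U] /= LU].
  have [M [L' [U' [Mc Msub LU' sub sep]]]] := rich_step (q r) LU.
  by exists (M, exist _ (L', U') LU').
have [f fP] := choice step.
pose I := fix I r := if r is r'.+1 then (f (r', I r')).2
  else exist (fun P : set H * set H => rich P.1 P.2) ([set 0], setT) rich0 : interval.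
have I_mono r s : (r <= s)%N ->
    (sval (I r)).1 `<=` (sval (I s)).1 /\ (sval (I s)).2 `<=` (sval (I r)).2.
  elim: s => [|s IHs]; first by rewrite leqn0 => /eqP->; split=> x.
  rewrite leq_eqVlt => /predU1P[->|rs]; first by split=> x.
  have [sL sU] := IHs rs.
  have [_ _ [/= sL' sU'] _] := fP (s, I s).
  by split; [exact: subset_trans sL'|exact: subset_trans sU].
exists (fun r => (f (r, I r)).1); split=> [r|].
  by have [] := fP (r, I r).
have sep r s : (r < s)%N -> (f (r, I r)).1 (q r) `<=` (f (s, I s)).1 0 \/
    (f (s, I s)).1 (q s) `<=` (f (r, I r)).1 0.
  move=> rs; have [_ _ _ /= sepr] := fP (r, I r).
  have [_ [/= Ls sU] _ _] := fP (s, I s); have [/= rL sUr] := I_mono _ _ rs.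
  case: sepr => h; [left|right].
    by apply: subset_trans h _; apply: subset_trans rL _.
  by apply: subset_trans sU _; apply: subset_trans sUr _.
move=> r s; rewrite neq_ltn => /orP[] rs; first exact: sep.
by apply/or_comm; exact: sep.
Qed.

End Towers.

(** * Growth of a right inverse along a tree *)

Section GrowthEstimate.
Variables (R : realType) (H : hilbertType R) (N : nest H) (n : nat).
Hypothesis n0 : (0 < n)%N.
Variables (D : nat -> nat -> set H).
Hypothesis DN : forall r k, nest_set N (D r k).
Variables (A S B : 'I_n -> nest_algebra N).

(** This is 1 + n + ... + n^(i-1), the index of the first node of generation [i]; thus
    [tree_level r.+1] blocks hold exactly the generations 0 to [r]. *)
Fixpoint tree_level i : nat := if i is i'.+1 then (n * tree_level i').+1 else 0%N.

Lemma tree_level_mono i j : (i <= j)%N -> (tree_level i <= tree_level j)%N.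
Proof.
elim: j => [|j IHj]; first by rewrite leqn0 => /eqP->.
rewrite leq_eqVlt => /predU1P[->//|/IHj ij].
by rewrite (leq_trans ij)//= leqW// leq_pmull.
Qed.

Hypothesis A_mem : forall t r k x, D r k x -> D r (n * k).+1 (A t x).
Hypothesis A_ortho_mem : forall t r k z y, D r 0 z ->
  (forall y, D r k y -> inner z y = 0) -> D r (n * k).+1 y -> inner (A t z) y = 0.
Hypothesis A_lower : forall t r k z, D r 0 z ->
  (forall y, D r k y -> inner z y = 0) ->
  (n * k < tree_level r.+1)%N -> hnorm z <= hnorm (A t z).
Hypothesis A_ortho : forall s t x y, s != t -> inner (A s x) (A t y) = 0.
Hypothesis D0 : forall r, D r 1 `<` D r 0.
Hypothesis DS : forall r k, D r k `<=` D r 0.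

Let eps : R := (4 * n%:R)^-1.
Hypothesis SA : forall t x, hnorm (S t x - A t x) <= eps * hnorm x.
Hypothesis SB : forall x, \sum_t S t (B t x) = x.

Let Dc r k : closed_subspace (D r k).
Proof. exact: nest_closed_subspace (DN r k). Qed.

Let eps_ge0 : 0 <= eps. Proof. by rewrite invr_ge0 mulr_ge0. Qed.

Section Tower.
Variables (r : nat) (h : H).
Hypotheses (Dh : D r 0 h) (h1 : forall y, D r 1 y -> inner h y = 0) (hn0 : h != 0).

Let x t := B t h.
Let Dx t : D r 0 (x t).
Proof. by apply: (nest_stable (DN r 0)); exists h. Qed.

Let E t y := S t y - A t y.
Let E_mem t k y : D r k y -> D r k (E t y).
Proof. by move=> Dy; apply: closed_subspaceB => //; apply: (nest_stable (DN r k)); exists y. Qed.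

(** Its norm is the distance of [B t h] to [D r k]. *)
Let z k t := x t - proj (D r k) (x t).

Let p k := \sum_t hnorm (z k t).

Let p_ge0 k : 0 <= p k. Proof. by apply: sumr_ge0 => t _; exact: hnorm_ge0. Qed.

Let h_gt0 : 0 < hnorm h.
Proof. by rewrite lt_neqAle hnorm_ge0 andbT eq_sym; apply: contra_neq hn0; exact: hnorm_eq0. Qed.

Let h_split : h = \sum_t A t (x t) + \sum_t E t (x t).
Proof. by rewrite -big_split/= -[LHS]SB; apply: eq_bigr => t _; rewrite /E addrC subrK. Qed.

Let nest_map_split (T : nest_algebra N) k t :
  T (x t) = T (z k t) + T (proj (D r k) (x t)).
Proof.
by have := nest_linear T 1 (z k t) (proj (D r k) (x t)); rewrite !scale1r subrK.
Qed.

(** [E t] preserves [D r k], so [w] only sees its values at the [z k t]: the error is controlled by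
    [p k] instead of the full norms of the [x t]. *)
Let perturbation_le k w : (forall y, D r k y -> inner w y = 0) ->
  `|inner (\sum_t E t (x t)) w| <= (eps * p k * hnorm w)%:C%C.
Proof.
move=> wD; rewrite linear_sumlz (le_trans (ler_norm_sum _ _ _))//.
rewrite /p mulr_sumr mulr_suml rmorph_sum/=; apply: ler_sum => t _.
have -> : E t (x t) = E t (z k t) + E t (proj (D r k) (x t)).
  by rewrite /E (nest_map_split _ k) (nest_map_split (A t) k) opprD addrACA.
rewrite linearDl/= (inner_sym0 (wD _ (E_mem t (proj_mem (Dc r k) (x t))))) addr0.
rewrite (le_trans (cauchy_schwarz _ _))// !hnormE -rmorphM lecR.
by rewrite ler_wpM2r// ?hnorm_ge0//; exact: SA.
Qed.

(** All [A t (x t)] lie in [D r 1], to which [h] is orthogonal; the perturbation alone must produce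
    [inner h h]. *)
Let growth_start : hnorm h <= eps * p 1.
Proof.
have hh : inner h h = inner (\sum_t E t (x t)) h.
  rewrite {1}h_split linearDl/= linear_sumlz big1 ?add0r// => t _.
  by apply/inner_sym0/h1; have := A_mem t (Dx t); rewrite muln0.
rewrite -(ler_pM2r h_gt0) -expr2 -lecR hnorm_sqr -(ger0_norm (dnorm_ge0 _ h)) hh.
exact: perturbation_le.
Qed.

(** The splitting of [h] is paired with [w], the image of [z k t] under [A t]. The other columns
    have ranges orthogonal to [w], and the part of [x t] in [D r k] is sent into [D r (n * k).+1],
    orthogonal to [w]: what remains is [inner w w] and the error. *)
Let growth_step k : (n * k < tree_level r.+1)%N ->
  p k <= n%:R * (hnorm h + eps * p (n * k).+1).
Proof.
move=> kq; rewrite -[n in n%:R]card_ord -sum1_card natr_sum mulr_suml.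
apply: ler_sum => t _; rewrite mul1r.
have z_ortho y : D r k y -> inner (z k t) y = 0 by exact: proj_ortho.
have Dz : D r 0 (z k t).
  by apply: closed_subspaceB => //; apply: (@DS r k); exact: proj_mem.
pose w := A t (z k t).
have wD y : D r (n * k).+1 y -> inner w y = 0 by exact: A_ortho_mem.
apply: (le_trans (A_lower t Dz z_ortho kq)); rewrite -/w.
have [->|w0] := eqVneq w 0.
  by rewrite hnorm0 addr_ge0 ?hnorm_ge0// mulr_ge0.
have w_gt0 : 0 < hnorm w.
  by rewrite lt_neqAle hnorm_ge0 andbT eq_sym; apply: contra_neq w0; exact: hnorm_eq0.
have ww : inner w w = inner h w - inner (\sum_t E t (x t)) w.
  rewrite {1}h_split linearDl/= addrK linear_sumlz (bigD1 t)//= big1 ?addr0; last first.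
    by move=> s st; exact: A_ortho.
  rewrite (nest_map_split _ k) linearDl/= -/w.
  by rewrite (inner_sym0 (wD _ (A_mem t (proj_mem (Dc r k) (x t))))) addr0.
rewrite -(ler_pM2r w_gt0) mulrDl -expr2 -lecR hnorm_sqr rmorphD/=.
rewrite -(ger0_norm (dnorm_ge0 _ w)) ww (le_trans (ler_normB _ _))//.
apply: lerD; last exact: perturbation_le.
by rewrite rmorphM/= -!hnormE cauchy_schwarz.
Qed.

Lemma tower_growth : 2 ^+ r * hnorm h <= \sum_t hnorm (B t h).
Proof.
have n_gt0 : 0 < n%:R :> R by rewrite ltr0n.
(* With d = n |h| and c = 2^i d, the bounds 4 c <= p and p <= d + p' / 4 give p' >= 16 c - 4 d >= 12
   c, more than the required 8 c. *)
have growth i : (i <= r)%N -> 2 ^+ i * (4 * n%:R * hnorm h) <= p (tree_level i.+1).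
  elim: i => [_|i IHi ir].
    rewrite expr0 mul1r /= muln0 mulrC -ler_pdivlMr ?mulr_gt0// mulrC.
    exact: growth_start.
  have kq : (n * tree_level i.+1 < tree_level r.+1)%N.
    exact: (@tree_level_mono i.+2).
  have := growth_step kq; have := IHi (ltnW ir).
  rewrite -/(tree_level i.+2) exprS.
  move: (p (tree_level i.+1)) (p (tree_level i.+2)) => a b.
  have -> : n%:R * (hnorm h + eps * b) = n%:R * hnorm h + b / 4.
    by rewrite mulrDr /eps invfM; field; rewrite gt_eqF.
  have : n%:R * hnorm h <= 2 ^+ i * (n%:R * hnorm h).
    by rewrite ler_peMl ?mulr_ge0 ?hnorm_ge0// exprn_ege1// ler1n.
  rewrite -[4 * n%:R * hnorm h]mulrA.
  have : 0 <= n%:R * hnorm h by rewrite mulr_ge0 ?hnorm_ge0.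
  rewrite -!mulrA [2 ^+ i * (4 * _)]mulrCA.
  move: (n%:R * hnorm h) => d; move: (2 ^+ i * d) => c; lra.
apply: (@le_trans _ _ (p (tree_level r.+1))).
  apply: le_trans (growth r (leqnn r)); rewrite ler_wpM2l ?exprn_ge0//.
  by rewrite ler_peMl ?hnorm_ge0// -natrM ler1n muln_gt0.
by apply: ler_sum => t _; exact: hnormB_proj_le.
Qed.

End Tower.

Lemma tower_growth_contra : False.
Proof.
pose b := \sum_t opnorm (B t).
have b0 : 0 <= b by apply: sumr_ge0 => t _; exact: nest_opnorm_ge0.
(* The height is chosen after [B], with b < r < 2^r; the part of [x] orthogonal to [D r 1] is the
   nonzero vector at the root. *)
pose r := Num.bound b; have [_ /existsNP[x /not_implyP[D0x D1x]]] := D0 r.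
pose h := x - proj (D r 1) x.
have h0 : h != 0.
  by rewrite subr_eq0; apply: contra_notN D1x => /eqP->; exact: proj_mem.
have Dh : D r 0 h by apply: closed_subspaceB => //; apply: (@DS r 1); exact: proj_mem.
have h1 y : D r 1 y -> inner h y = 0 by exact: proj_ortho.
have := tower_growth Dh h1 h0.
have h_gt0 : 0 < hnorm h.
  by rewrite lt_neqAle hnorm_ge0 andbT eq_sym; apply: contra_neq h0; exact: hnorm_eq0.
apply/negP; rewrite -ltNge (@le_lt_trans _ _ (b * hnorm h))//.
  rewrite /b mulr_suml; apply: ler_sum => t _.
  by rewrite -lecR rmorphM/= -!hnormE; exact: nest_opnormP.
rewrite ltr_pM2r// (lt_trans (archi_boundP b0))// -natrX ltr_nat.
exact: ltn_expl.
Qed.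

End GrowthEstimate.

(** * No length of rows has dense right unimodular rows *)

Theorem corollary5p5 (R : realType) (H : hilbertType R) (N : nest H) :
  (forall q : nat, (0 < q)%N -> exists M : nat -> set H,
    [/\ forall j, (j <= q)%N -> nest_set N (M j),
        forall j, (j < q)%N -> M j `<` M j.+1
      & forall j, (1 <= j < q)%N ->
          hdim_le (orthogonal_difference (M j.+1) (M j))
                  (orthogonal_difference (M j) (M j.-1))]) ->
  rtsr (nest_algebra N) = +oo%E.
Proof.
move=> Nc; rewrite /rtsr (_ : [set n | _] = set0) ?image_set0 ?ereal_inf0//.
apply/seteqP; split=> // n [n0 nd].
pose q r := tree_level n r.+1.
have [M [Mc Msep]] := separated_towers q Nc.
(* The chain is numbered from its top; truncated subtraction makes [D r k] the bottom [M r 0] for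
   every [k] from [q r] on. *)
pose D r k := M r (q r - k)%N.
have Mmono r i j : (i <= j <= q r)%N -> M r i `<=` M r j.
  exact: dim_chain_mono.
have DN r k : nest_set N (D r k).
  by have [MN _ _] := Mc r; apply: MN; exact: leq_subr.
have DS r j k : (j <= k)%N -> D r k `<=` D r j.
  by move=> jk; apply: Mmono; rewrite leq_subr leq_sub2l.
have Dsep r s : r != s ->
    (forall k, D r 0 `<=` D s k) \/ (forall k, D s 0 `<=` D r k).
  move=> /Msep[] rs; [left|right] => k; rewrite /D subn0.
    by apply: subset_trans rs _; apply: Mmono; rewrite leq_subr.
  by apply: subset_trans rs _; apply: Mmono; rewrite leq_subr.
have Ddim r k : (k.+1 < q r)%N ->
    hdim_le (orthogonal_difference (D r k) (D r k.+1))
            (orthogonal_difference (D r k.+1) (D r k.+2)).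
  move=> kq; have [_ _ Md] := Mc r; have := Md (q r - k.+1)%N.
  rewrite /D -subSn ?(ltnW kq)// subSS -subnS; apply.
  by rewrite subn_gt0 kq leq_subr.
have D0 r : D r 1 `<` D r 0.
  have [_ Mlt _] := Mc r; rewrite /D subn0 subn1.
  by apply: (Mlt (q r).-1).
have [A [Am Aom Al Ao]] := nest_shifts n DN (fun r k => DS r k k.+1 (leqnSn k)) Dsep Ddim.
pose a : 'rV[nest_algebra N]_n := \row_t A t.
pose eps : R := (4 * n%:R)^-1.
have eps0 : 0 < eps by rewrite invr_gt0 mulr_gt0// ltr0n.
have epsC : (0 : R[i]) < eps%:C%C by rewrite ltcR.
(* Density is tested on open sets, hence the interior; the ball bounds each entry of [a - s] by
   [eps]. *)
have [|s [sa [b sb]]] := nd (ball a eps%:C%C)^° _ (@open_interior _ _).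
  by exists a; exact: nbhsx_ballx.
have {}sa := interior_subset sa.
apply: (@tower_growth_contra _ _ N n n0 D DN A (s 0) (b 0)) => //.
- by move=> r k; exact: DS.
- move=> t x; have := sa.2 0 t; rewrite mxE -ball_normE/= => st.
  rewrite -lecR rmorphM/= -!hnormE distrC.
  rewrite (le_trans (@nest_opnormP _ _ N (A t - s 0 t) x))//.
  by rewrite ler_wpM2r// ltW.
- move=> x.
  have sbx := congr1 (fun T : nest_algebra N => T x) sb.
  by rewrite -[RHS]sbx; apply/esym/(big_morph (fun T : nest_algebra N => T x)).
Qed.
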